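(* There exists a language $L_0$ over the alphabet $\Sigma_0=\{a,b,c,d,e,\#\}$, described by a grammar with left contexts, such that for every finite alphabet $\Sigma$ and every language $L\subseteq\Sigma^*$ the following holds. If $\varepsilon\notin L$, then $L$ is described by a grammar with left contexts if and only if $L=h^{-1}(L_0)$ for some homomorphism $h\colon\Sigma^*\to\Sigma_0^*$. If $\varepsilon\in L$, then $L$ is described by a grammar with left contexts if and only if $L=h^{-1}(L_0\cup\{\varepsilon\})$ for some homomorphism $h\colon\Sigma^*\to\Sigma_0^*$.
   Context: **Grammars with left contexts.** A grammar with left contexts is a quadruple $G=(\Sigma,N,R,S)$, where $\Sigma$ is a finite alphabet, $N$ is a finite set of nonterminal symbols disjoint from $\Sigma$, $S\in N$ is the initial symbol, and $R$ is a finite set of rules of the form $$A\to \alpha_1\,\&\,\ldots\,\&\,\alpha_k\,\&\,{\lhd}\beta_1\,\&\,\ldots\,\&\,{\lhd}\beta_m\,\&\,{\trianglelefteq}\gamma_1\,\&\,\ldots\,\&\,{\trianglelefteq}\gamma_n,$$ with $A\in N$, $k\ge 1$, $m,n\ge 0$, $\alpha_i,\beta_i,\gamma_i\in(\Sigma\cup N)^*$. For $u,v\in\Sigma^*$, write $u\langle v\rangle$ for the string $v$ in the left context $u$ (formally a pair $(u,v)$). Propositions $X(u\langle v\rangle)$, with $X\in\Sigma\cup N$, are derived as follows. Axioms: $a(x\langle a\rangle)$ for all $a\in\Sigma$, $x\in\Sigma^*$. Each rule $A\to \alpha_1\,\&\,\ldots\,\&\,\alpha_k\,\&\,{\lhd}\beta_1\,\&\,\ldots\,\&\,{\lhd}\beta_m\,\&\,{\trianglelefteq}\gamma_1\,\&\,\ldots\,\&\,{\trianglelefteq}\gamma_n$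 in $R$ allows one to derive $A(u\langle v\rangle)$ from already derived propositions if: (i) for every conjunct $\alpha_i=X_1\ldots X_\ell$ there is a partition $v=v_1\ldots v_\ell$ such that $X_j(uv_1\ldots v_{j-1}\langle v_j\rangle)$ is derived for all $j$; (ii) for every conjunct ${\lhd}\beta_i={\lhd}X_1\ldots X_\ell$ there is a partition $u=u_1\ldots u_\ell$ such that $X_j(u_1\ldots u_{j-1}\langle u_j\rangle)$ is derived for all $j$; (iii) for every conjunct ${\trianglelefteq}\gamma_i={\trianglelefteq}X_1\ldots X_\ell$ there is a partition $uv=w_1\ldots w_\ell$ such that $X_j(w_1\ldots w_{j-1}\langle w_j\rangle)$ is derived for all $j$. For $\ell=0$ these conditions mean $v=\varepsilon$, $u=\varepsilon$, $uv=\varepsilon$, respectively. The language described by $G$ is $L(G)=\{w\in\Sigma^*\mid S(\varepsilon\langle w\rangle)\text{ is derivable}\}$. A homomorphism $h\colon\Sigma^*\to\Sigma_0^*$ is a monoid homomorphism of free monoids, and $h^{-1}(K)=\{w\in\Sigma^*\mid h(w)\in K\}$. *)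

(* Defs.v *)
From HB Require Import structures.
From mathcomp Require Import all_boot.

Set Implicit Arguments.
Unset Strict Implicit.
Unset Printing Implicit Defensive.

Definition language (Sigma : Type) := seq Sigma -> Prop.

Definition lang_eq (Sigma : Type) (K L : language Sigma) : Prop :=
  forall w, K w <-> L w.

Definition lang_add_eps (Sigma : Type) (K : language Sigma) : language Sigma :=
  fun w => K w \/ w = [::].

Definition str_morphism (Sigma Gamma : Type) (h : seq Sigma -> seq Gamma) :
    Prop :=
  h [::] = [::] /\ forall u v, h (u ++ v) = h u ++ h v.

Definition lang_preim (Sigma Gamma : Type) (h : seq Sigma -> seq Gamma)
    (K : language Gamma) : language Sigma :=
  fun w => K (h w).

(* The disjoint sum makes the terminal and nonterminal alphabets disjoint. *)
Definition symbol (Sigma N : finType) : finType := (Sigma + N)%type.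

(* The rule  rlhs -> &_i alpha_i & &_i <| beta_i & &_i <|= gamma_i,  with
   [rconj], [rleft] and [rext] the lists of the alpha_i, beta_i and gamma_i. *)
Record rule (Sigma N : finType) := Rule {
  rlhs : N;
  rconj : seq (seq (symbol Sigma N));
  rleft : seq (seq (symbol Sigma N));
  rext : seq (seq (symbol Sigma N))
}.

Section RuleEq.
Variables Sigma N : finType.

Definition rule_code (r : rule Sigma N) :=
  (rlhs r, rconj r, rleft r, rext r).

Definition rule_decode
    (c : N * seq (seq (symbol Sigma N)) * seq (seq (symbol Sigma N)) *
         seq (seq (symbol Sigma N))) : rule Sigma N :=
  let: (A, s, t, q) := c in Rule A s t q.

Lemma rule_codeK : cancel rule_code rule_decode.
Proof. by case. Qed.

HB.instance Definition _ := Equality.copy (rule Sigma N) (can_type rule_codeK).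
End RuleEq.

Record grammar (Sigma : finType) := Grammar {
  gnt : finType;
  gstart : gnt;
  grules : seq (rule Sigma gnt);
  grules_conj : all (fun r => 0 < size (rconj r)) grules
}.

(* [derives G X u v] is the derivability of the proposition X(u<v>), and
   [derives_seq G [:: X_1; ...; X_l] u v] says that v has a partition
   v = v_1 ... v_l such that each X_j(u v_1 ... v_(j-1) <v_j>) is derivable. *)
Inductive derives (Sigma : finType) (G : grammar Sigma) :
    symbol Sigma (gnt G) -> seq Sigma -> seq Sigma -> Prop :=
| derives_axiom (a : Sigma) (x : seq Sigma) : derives (inl a) x [:: a]
| derives_rule (r : rule Sigma (gnt G)) (u v : seq Sigma) :
    r \in grules G ->
    (forall alpha, alpha \in rconj r -> derives_seq alpha u v) ->
    (forall beta, beta \in rleft r -> derives_seq beta [::] u) ->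
    (forall gamma, gamma \in rext r -> derives_seq gamma [::] (u ++ v)) ->
    derives (inr (rlhs r)) u v
with derives_seq (Sigma : finType) (G : grammar Sigma) :
    seq (symbol Sigma (gnt G)) -> seq Sigma -> seq Sigma -> Prop :=
| derives_nil (u : seq Sigma) : derives_seq [::] u [::]
| derives_cons (X : symbol Sigma (gnt G)) (s : seq (symbol Sigma (gnt G)))
    (u v w : seq Sigma) :
    derives X u v -> derives_seq s (u ++ v) w ->
    derives_seq (X :: s) u (v ++ w).

Definition grammar_lang (Sigma : finType) (G : grammar Sigma) :
    language Sigma :=
  fun w => derives (G := G) (inr (gstart G)) [::] w.

Definition described (Sigma : finType) (L : language Sigma) : Prop :=
  exists G : grammar Sigma, lang_eq L (grammar_lang G).

Inductive letter := La | Lb | Lc | Ld | Le | Lhash.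

Definition letter_code (x : letter) : 'I_6 :=
  match x with
  | La => @Ordinal 6 0 isT | Lb => @Ordinal 6 1 isT | Lc => @Ordinal 6 2 isT
  | Ld => @Ordinal 6 3 isT | Le => @Ordinal 6 4 isT | Lhash => @Ordinal 6 5 isT
  end.

Definition letter_decode (i : 'I_6) : letter :=
  nth Lhash [:: La; Lb; Lc; Ld; Le; Lhash] i.

Lemma letter_codeK : cancel letter_code letter_decode.
Proof. by case. Qed.

HB.instance Definition _ := Finite.copy letter (can_type letter_codeK).

(* Main.v *)
From HB Require Import structures.
Require Import Defs.
From mathcomp Require Import all_boot.
From mathcomp.classical Require Import boolp.

(* A grammar G over Sigma is first replaced by finitely many "tokens", each
   asserting "if the prefixes ending where this substring starts and ends
   belong to prescribed sets of bodies, then the body s is derivable here".  A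
   token about [u <v c w>] is inferred in one step by cutting the string at a
   letter [c], from tokens about [u <v>] and [u v c <w>], and from tokens about
   the prefix [u v], which account for the contexts.  For each [c], all the
   semantically sound inferences of this shape are allowed; there are finitely
   many of them, and an induction on derivations in G shows that they suffice.
   No elimination of empty strings, unit rules or context operators is needed.

   The homomorphism sends a letter [c] to a list of its inferences.  An
   inference with conclusion number n is written between the lists of numbers
   of the tokens it requires to its left and to its right.  A required token is
   thus named at one end of its substring, and the fixed grammar matches this
   unary name with the conclusion of an inference listed at an interior letter.

   Conversely, for the preimage under a homomorphism h, the nonterminals are
   triples (s, xi, t): on [u <v>], such a triple means that [h v ++ t] starts
   with s and that xi derives the remainder in the left context [h u ++ s]. *)

Set Implicit Arguments.
Unset Strict Implicit.
Unset Printing Implicit Defensive.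

(* Induction on derivations and interpretations of nonterminals *)
Scheme derives_mut := Induction for derives Sort Prop
  with derives_seq_mut := Induction for derives_seq Sort Prop.
Combined Scheme derives_both from derives_mut, derives_seq_mut.

Section Derivations.
Variables (Sigma : finType) (G : grammar Sigma).
Implicit Types (u v w : seq Sigma) (X : symbol Sigma (gnt G)).

Lemma derives_seq1 X u v : derives_seq [:: X] u v <-> derives X u v.
Proof.
split=> [H|H]; last first.
  by rewrite -[v]cats0; apply: derives_cons => //; apply: derives_nil.
inversion H as [|X0 s0 u0 v1 w0 HX Hs]; subst; inversion Hs; subst.
by rewrite cats0.
Qed.

Lemma derives_seq0 u v : derives_seq (G := G) [::] u v <-> v = [::].
Proof. by split=> [H|->]; [inversion H|apply: derives_nil]. Qed.

Lemma derives_seq_term (a : Sigma) s u v :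
  derives_seq (G := G) s (rcons u a) v -> derives_seq (inl a :: s) u (a :: v).
Proof.
move=> H; apply: (@derives_cons _ _ _ _ _ [:: a] v); first exact: derives_axiom.
by rewrite cats1.
Qed.

Section Model.
Variable I : gnt G -> seq Sigma -> seq Sigma -> Prop.

Definition sym_interp X u v :=
  match X with inl a => v = [:: a] | inr A => I A u v end.

Fixpoint seq_interp (s : seq (symbol Sigma (gnt G))) u v :=
  if s is X :: s' then
    exists v1 v2, [/\ v = v1 ++ v2, sym_interp X u v1
      & seq_interp s' (u ++ v1) v2]
  else v = [::].

(** Derivability is the least family closed under the rules, so any interpretation [I] closed under
    them contains it. Soundness of both constructed grammars is proved by exhibiting such an [I]. *)
Lemma derives_interp :
  (forall r, r \in grules G -> forall u v,
    (forall s, s \in rconj r -> seq_interp s u v) ->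
    (forall s, s \in rleft r -> seq_interp s [::] u) ->
    (forall s, s \in rext r -> seq_interp s [::] (u ++ v)) ->
    I (rlhs r) u v) ->
  forall X u v, derives X u v -> sym_interp X u v.
Proof.
move=> closed X u v HX.
apply: (derives_mut (P := fun X u v _ => sym_interp X u v)
  (P0 := fun s u v _ => seq_interp s u v)) HX => //=.
by move=> r u' v' Hr _ IHc _ IHl _ IHe; apply: closed.
by move=> Y s u' v' w _ IHX _ IHs; exists v', w.
Qed.
End Model.
End Derivations.

(** * Token systems and their encoding *)

Definition catE (T : Type) :=
  (fun x y z : seq T => esym (catA x y z), @cat_cons T, @cat_rcons T,
   @rcons_cat T, @rcons_cons T).

Lemma cat_sep_first (T : eqType) (a : T) x x' y y' :
  a \notin x -> a \notin x' -> x ++ a :: y = x' ++ a :: y' -> x = x' /\ y = y'.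
Proof.
elim: x x' => [|b x IH] [|b' x'] //=.
- by move=> _ _ [].
- by rewrite inE negb_or => _ /andP[/eqP ne _] [/ne].
- by rewrite inE negb_or => /andP[/eqP ne _] _ [] /esym /ne.
rewrite !inE !negb_or => /andP[_ hx] /andP[_ hx'] [<- /(IH _ hx hx')].
by case=> -> ->.
Qed.

Lemma cat_sep_last (T : eqType) (a : T) x x' y y' :
  a \notin y -> a \notin y' -> x ++ a :: y = x' ++ a :: y' -> x = x' /\ y = y'.
Proof.
move=> hy hy' /(congr1 rev); rewrite !rev_cat !rev_cons !cat_rcons.
case/cat_sep_first; rewrite ?mem_rev //.
by move=> /(can_inj revK) -> /(can_inj revK) ->.
Qed.

Lemma cat_injr (T : eqType) (x y z : seq T) : x ++ z = y ++ z -> x = y.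
Proof.
elim: z x y => [|a z IH] x y; first by rewrite !cats0.
by rewrite -!cat_rcons => /IH /rcons_inj[].
Qed.

Lemma rcons_nseq (T : Type) (a : T) m : rcons (nseq m a) a = nseq m.+1 a.
Proof. by elim: m => //= m ->. Qed.

Lemma cat_nseq_eq (T : eqType) (a b : T) m n x y :
  a != b -> nseq m a ++ b :: x = nseq n a ++ b :: y -> m = n /\ x = y.
Proof.
move=> /eqP ne; elim: m n => [|m IH] [|n] //=.
- by case.
- by case=> /esym /ne.
- by case=> /ne.
by case=> /IH[-> ->].
Qed.

Notation entry := (nat * (seq nat * seq nat * seq nat))%type.

Section Tokens.
Variables (Sigma : Type) (E : Sigma -> seq entry).

(* Token 0 asserts emptiness and is never inferred from an entry, so the entries
   numbered 0 are free to express acceptance. *)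
Inductive tok : nat -> seq Sigma -> seq Sigma -> Prop :=
| tok_empty u : tok 0 u [::]
| tok_split n u v c w K B C :
    (n.+1, (K, B, C)) \in E c ->
    (forall k, k \in K -> tok k [::] (u ++ v)) ->
    (forall k, k \in B -> tok k u v) ->
    (forall k, k \in C -> tok k (u ++ rcons v c) w) ->
    tok n.+1 u (v ++ c :: w).

Definition accepts (w : seq Sigma) : Prop :=
  exists v c K C, [/\ w = rcons v c, (0, (K, [::], C)) \in E c
    & forall k, k \in K -> tok k [::] v].

(** The separator comes first in [encR], so that a substring ending after a name has this whole name
    after its last [Lb]; this serves K and B, whose tokens end near the entry. The mirror image
    [encL] serves C, whose tokens start there. *)
Definition encR (l : seq nat) := flatten [seq Lb :: nseq k La | k <- l].
Definition encL (l : seq nat) := flatten [seq rcons (nseq k La) Lb | k <- l].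
Definition enc_entry (e : entry) :=
  let: (n, (K, B, C)) := e in
  Lc :: encR K ++ Ld :: encR B ++ Ld :: nseq n La ++ Le :: encL C ++ [:: Le].
Definition enc_letter c := rcons (flatten [seq enc_entry e | e <- E c]) Lhash.
Definition enc w := flatten [seq enc_letter c | c <- w].

Lemma encR_rcons l k : encR (rcons l k) = encR l ++ Lb :: nseq k La.
Proof. by rewrite /encR map_rcons flatten_rcons. Qed.

Lemma encL_cons l k : encL (k :: l) = nseq k La ++ Lb :: encL l.
Proof. by rewrite /encL /= cat_rcons. Qed.

Lemma mem_encR x l : x != La -> x != Lb -> x \notin encR l.
Proof.
move=> ha hb; elim: l => //= k l IH.
by rewrite inE mem_cat mem_nseq !negb_or hb (negPf ha) andbF.
Qed.

Lemma mem_encL x l : x != La -> x != Lb -> x \notin encL l.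
Proof.
move=> ha hb; elim: l => //= k l IH.
by rewrite encL_cons mem_cat inE mem_nseq !negb_or hb (negPf ha) andbF.
Qed.

Lemma enc_cat u v : enc (u ++ v) = enc u ++ enc v.
Proof. by rewrite /enc map_cat flatten_cat. Qed.

Lemma enc_cons c v : enc (c :: v) = enc_letter c ++ enc v.
Proof. by []. Qed.

Lemma enc_eq0 v : enc v = [::] -> v = [::].
Proof. by case: v => //= c v; rewrite enc_cons /enc_letter; case: flatten. Qed.

Lemma encR_inj : injective encR.
Proof.
elim/last_ind => [|K k IH]; elim/last_ind => [|K' k' _] //;
  rewrite ?encR_rcons; [by case: (encR K')|by case: (encR K)|].
case/cat_sep_last => [||/IH -> /(congr1 size)]; rewrite ?mem_nseq ?andbF //.
by rewrite !size_nseq => ->.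
Qed.

(** An encoded list contains no [Ld] and the run of [La] stops at [Le], so reading from the left
    determines K, B and n. *)
Lemma enc_entry_parse e x K B n y :
  enc_entry e ++ x =
    Lc :: encR K ++ Ld :: encR B ++ Ld :: nseq n La ++ Le :: y ->
  exists C, e = (n, (K, B, C)) /\ y = encL C ++ Le :: x.
Proof.
case: e => n' [[K' B'] C'] /= []; rewrite !catE /=.
case/cat_sep_first; rewrite ?mem_encR // => /encR_inj <-.
case/cat_sep_first; rewrite ?mem_encR // => /encR_inj <-.
by case/cat_nseq_eq => // <- <-; exists C'.
Qed.

Lemma mem_enc_entry e : Lhash \notin enc_entry e.
Proof.
case: e => n [[K B] C] /=.
by rewrite !(inE, mem_cat) !negb_or !mem_encR // !mem_encL // mem_nseq andbF.
Qed.

Lemma mem_enc_entries es : Lhash \notin flatten [seq enc_entry e | e <- es].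
Proof.
elim: es => //= e es IH.
by rewrite mem_cat negb_or mem_enc_entry.
Qed.

(* [Lc] occurs in an encoded text only as the head of an entry. *)
Lemma enc_entry_head e x y z :
  enc_entry e ++ x = y ++ Lc :: z ->
  y = [::] \/ exists2 y', y = enc_entry e ++ y' & x = y' ++ Lc :: z.
Proof.
have [t -> ht] : exists2 t, enc_entry e = Lc :: t & Lc \notin t.
  case: e => n [[K B] C]; eexists; first by [].
  by rewrite !(inE, mem_cat) !negb_or !mem_encR // !mem_encL // mem_nseq andbF.
case: y => [|b y] /=; [by left|case=> <- e1; right].
suff [y' -> ->] : exists2 y', y = t ++ y' & x = y' ++ Lc :: z by exists y'.
elim: t y ht e1 => [|b' t IH] y /=; first by move=> _ ->; exists y.
rewrite inE negb_or => /andP[/eqP ne ht].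
by case: y => [|b'' y] [] => [/esym/ne//|<- /(IH _ ht)[y' -> ->]]; exists y'.
Qed.

Lemma enc_entries_head es rest y z :
  flatten [seq enc_entry e | e <- es] ++ Lhash :: rest = y ++ Lc :: z ->
  (exists es1 e es2, [/\ es = es1 ++ e :: es2,
     y = flatten [seq enc_entry e' | e' <- es1] &
     enc_entry e ++ flatten [seq enc_entry e' | e' <- es2] ++ Lhash :: rest
       = Lc :: z]) \/
  exists2 y', y = flatten [seq enc_entry e | e <- es] ++ Lhash :: y'
    & rest = y' ++ Lc :: z.
Proof.
elim: es y => [|e es IH] y /=.
  by case: y => [|b y] //= [<- ->]; right; exists y.
rewrite -catA => H; have [y0|[y' -> /IH H']] := enc_entry_head H.
  by left; exists [::], e, es; rewrite H y0.
case: H' => [[es1 [e1 [es2 [-> -> <-]]]]|[y'' -> ->]].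
  by left; exists (e :: es1), e1, es2.
by right; exists y''; rewrite // -catA.
Qed.

(** Unique readability: a factor shaped like the beginning of an entry is a genuine entry of some
    letter. The strings [s1] and [s2] encode the other entries of this letter; being free of
    [Lhash], they stay inside its block. *)
Lemma enc_locate v x K B n y :
  enc v = x ++ Lc :: encR K ++ Ld :: encR B ++ Ld :: nseq n La ++ Le :: y ->
  exists v1 c v2 s1 s2 C, [/\ v = v1 ++ c :: v2, (n, (K, B, C)) \in E c,
    x = enc v1 ++ s1, y = encL C ++ Le :: rcons s2 Lhash ++ enc v2
    & (Lhash \notin s1) && (Lhash \notin s2)].
Proof.
elim: v x => [|c v IH] x; first by case: x.
rewrite enc_cons /enc_letter cat_rcons => /enc_entries_head[]; last first.
  case=> x' -> /IH[v1 [c' [v2 [s1 [s2 [C [-> hE -> -> hs]]]]]]].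
  exists (c :: v1), c', v2, s1, s2, C; split=> //.
  by rewrite enc_cons /enc_letter cat_rcons -catA.
case=> es1 [e [es2 [hE -> /enc_entry_parse[C [he ->]]]]].
exists [::], c, v, (flatten [seq enc_entry e' | e' <- es1]),
  (flatten [seq enc_entry e' | e' <- es2]), C.
rewrite hE he mem_cat inE eqxx orbT; split=> //.
  by rewrite cat_rcons.
by rewrite !mem_enc_entries.
Qed.

Lemma enc_rcons v c : enc (rcons v c) = enc v ++ enc_letter c.
Proof. by rewrite -cats1 enc_cat /enc /= cats0. Qed.

Lemma enc_last w : w <> [::] -> exists z, enc w = rcons z Lhash.
Proof.
case/lastP: w => // w c _; rewrite enc_rcons /enc_letter -rcons_cat.
by eexists.
Qed.

Lemma enc_letter_split c n K B C :
  (n, (K, B, C)) \in E c ->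
  exists s1 s2, [/\ Lhash \notin s1, Lhash \notin s2 &
    enc_letter c = s1 ++ Lc :: encR K ++ Ld :: encR B ++ Ld :: nseq n La ++
      Le :: encL C ++ Le :: rcons s2 Lhash].
Proof.
rewrite /enc_letter; case/splitPr => es1 es2.
exists (flatten [seq enc_entry e | e <- es1]),
  (flatten [seq enc_entry e | e <- es2]).
rewrite !mem_enc_entries; split=> //.
rewrite map_cat flatten_cat /= rcons_cat /=.
by rewrite rcons_cat !catE.
Qed.

End Tokens.

(** * The universal grammar *)

Inductive univ_nt :=
  NStart | NForm | NPrefix | NRight | NTokR | NPairR
| NLeft | NTokL | NPairL | NAny | NSkip | NRun.

Definition univ_nt_code (A : univ_nt) : 'I_12 :=
  inord match A with
  | NStart => 0 | NForm => 1 | NPrefix => 2 | NRight => 3 | NTokR => 4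
  | NPairR => 5 | NLeft => 6 | NTokL => 7 | NPairL => 8 | NAny => 9
  | NSkip => 10 | NRun => 11
  end.

Definition univ_nt_decode (i : 'I_12) : univ_nt :=
  nth NStart [:: NStart; NForm; NPrefix; NRight; NTokR; NPairR; NLeft; NTokL;
    NPairL; NAny; NSkip; NRun] i.

Lemma univ_nt_codeK : cancel univ_nt_code univ_nt_decode.
Proof. by case; rewrite /univ_nt_decode inordK. Qed.

HB.instance Definition _ := Finite.copy univ_nt (can_type univ_nt_codeK).

Lemma mem_second (T : eqType) (a b : T) : b \in [:: a; b].
Proof. by rewrite !inE eqxx orbT. Qed.

Section UniversalGrammar.

Let t (x : letter) : symbol letter univ_nt := inl x.
Let n (A : univ_nt) : symbol letter univ_nt := inr A.

(* [NTokR] reads a token whose name is at the right end of its substring, and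
   [NTokL] one whose name is at the left end.  [NRight] reads a substring ending
   inside an entry just after its list B, or a part of B, and checks the tokens
   in K and in that part; it calls [NPrefix] in an extended context to check K.
   [NLeft] checks a final part of a list C at the beginning of its substring.
   [NPairR] and [NPairL] match the two copies of a token name. *)
Definition univ_main_rules : seq (rule letter univ_nt) :=
  [:: Rule NAny [:: [::]] [::] [::];
      Rule NSkip [:: [::]] [::] [::];
      Rule NRun [:: [::]] [::] [::];
      Rule NRun [:: [:: t La; n NRun]] [::] [::];
      Rule NStart [:: [:: n NPrefix; t Ld; t Ld; t Le; n NSkip; t Lhash]]
        [::] [::];
      Rule NForm [:: [:: n NAny; t Lc]] [::] [::];
      Rule NForm [:: [:: n NForm; t Lb; n NRun]] [::] [::];
      Rule NPrefix [:: [:: n NAny; t Lc]] [::] [::];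
      Rule NPrefix [:: [:: n NPrefix; t Lb; n NRun]; [:: n NTokR]] [::] [::];
      Rule NRight [:: [:: n NForm; t Ld]] [::] [:: [:: n NPrefix; t Ld]];
      Rule NRight [:: [:: n NRight; t Lb; n NRun]; [:: n NTokR]] [::] [::];
      Rule NTokR [:: [:: n NSkip; t Lb]] [::] [::];
      Rule NTokR [:: [:: n NRight; t Ld; t La; n NPairR; t La]] [::] [::];
      Rule NPairR [:: [:: t La; n NPairR; t La]] [::] [::];
      Rule NPairR [:: [:: t Le; n NLeft; n NSkip; t Lb]] [::] [::];
      Rule NLeft [:: [:: t Le; n NAny; t Lhash]] [::] [::];
      Rule NLeft [:: [:: n NRun; t Lb; n NLeft]; [:: n NTokL]] [::] [::];
      Rule NTokL [:: [:: t Lb; n NSkip; t Lhash]] [::] [::];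
      Rule NTokL [:: [:: t La; n NPairL; t La; t Le; n NLeft]] [::] [::];
      Rule NPairL [:: [:: t La; n NPairL; t La]] [::] [::];
      Rule NPairL [:: [:: t Lb; n NSkip; t Lhash; n NRight; t Ld]] [::] [::]].

Definition univ_rules : seq (rule letter univ_nt) :=
  [seq Rule NAny [:: [:: t x; n NAny]] [::] [::]
    | x <- [:: La; Lb; Lc; Ld; Le; Lhash]] ++
  [seq Rule NSkip [:: [:: t x; n NSkip]] [::] [::]
    | x <- [:: La; Lb; Lc; Ld; Le]] ++
  univ_main_rules.

Definition univ_grammar : grammar letter :=
  @Grammar letter univ_nt NStart univ_rules isT.

End UniversalGrammar.

(** * Soundness of the universal grammar on encoded strings *)

Section Soundness.
Variables (Sigma : Type) (E : Sigma -> seq entry).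
Local Notation enc := (enc E).

(** The nonterminals also derive substrings that are not aligned with blocks. Tokens are therefore
    claimed only when the left context is some [enc u]; then [s1] is the part of the current block
    before the entry. *)
Definition sem_prefix (p s : seq letter) := exists z K, s = z ++ Lc :: encR K /\
  forall u v s1, p = enc u -> z = enc v ++ s1 -> Lhash \notin s1 ->
    forall k, k \in K -> tok E k u v.

Definition sem_right (p s : seq letter) := exists z K B,
  s = z ++ Lc :: encR K ++ Ld :: encR B /\
  forall u v s1, p = enc u -> z = enc v ++ s1 -> Lhash \notin s1 ->
    (forall k, k \in K -> tok E k [::] (u ++ v)) /\
    (forall k, k \in B -> tok E k u v).

(** Here the substring starts inside a block, whose part after the list is [r]. The final [Lhash] is
    recorded because it locates the last block boundary when a token name follows the substring. *)
Definition sem_left (p s : seq letter) := (exists z, s = rcons z Lhash) /\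
  forall u v C r, p ++ encL C ++ Le :: rcons r Lhash = enc u ->
    s = encL C ++ Le :: rcons r Lhash ++ enc v -> Lhash \notin r ->
    forall k, k \in C -> tok E k u v.

Definition univ_interp (A : univ_nt) (p s : seq letter) : Prop :=
  match A with
  | NStart => p = [::] -> forall w, s = enc w -> accepts E w
  | NForm => exists z K, s = z ++ Lc :: encR K
  | NPrefix => sem_prefix p s
  | NRight => sem_right p s
  | NTokR => forall u v r m, p = enc u -> s = enc v ++ r ++ Lb :: nseq m La ->
      Lhash \notin r -> tok E m u v
  | NPairR => exists m y r, [/\
      s = nseq m La ++ Le :: y ++ r ++ Lb :: nseq m La,
      Lhash \notin r & sem_left (p ++ rcons (nseq m La) Le) y]
  | NLeft => sem_left p s
  | NTokL => forall u v r m, p ++ nseq m La ++ Lb :: rcons r Lhash = enc u ->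
      s = nseq m La ++ Lb :: rcons r Lhash ++ enc v -> Lhash \notin r ->
      tok E m u v
  | NPairL => exists m r x, [/\
      s = nseq m La ++ Lb :: rcons r Lhash ++ x ++ Ld :: nseq m La,
      Lhash \notin r & sem_right (p ++ nseq m La ++ Lb :: rcons r Lhash) x]
  | NAny => True
  | NSkip => Lhash \notin s
  | NRun => exists m, s = nseq m La
  end.

(** Both [NTokR] and [NTokL] lead to this situation. The entry written across [x], the run and [y]
    is found by [enc_locate], and the three lists of premises of [tok_split] come from the meanings
    of [x] and [y]. *)
Lemma tok_of_split u v x m y :
  0 < m -> enc v = x ++ Ld :: nseq m La ++ Le :: y ->
  sem_right (enc u) x ->
  sem_left (enc u ++ x ++ Ld :: nseq m La ++ [:: Le]) y ->
  tok E m u v.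
Proof.
move=> m_gt0 ev [z [K [B [ex semR]]]] [_ semL].
move: (ev); rewrite {1}ex !catE.
case/enc_locate=> v1 [c [v2 [s1 [s2 [C [ev12 hE ez ey /andP[h1 h2]]]]]]].
have [hK hB] := semR u v1 s1 erefl ez h1.
rewrite ev12; case: m m_gt0 ev hE semL => // m _ ev hE semL.
apply: tok_split hE hK hB _; move: m.+1 ev semL => {}m ev semL.
apply: (semL (u ++ rcons v1 c) v2 C s2) => //.
have := ev; rewrite ev12 ey enc_cat enc_cons => eqv.
(* Cancelling [enc v2] isolates the block of [c], whose end is where the tokens of C start. *)
have {}eqv : enc v1 ++ enc_letter E c =
   x ++ Ld :: nseq m La ++ Le :: encL C ++ Le :: rcons s2 Lhash.
  move: eqv; rewrite -/(enc v2).
  rewrite [X in X = _ -> _]catA.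
  rewrite (_ : x ++ _ = (x ++ Ld :: nseq m La ++
    Le :: encL C ++ Le :: rcons s2 Lhash) ++ enc v2); last by
    rewrite !catE.
  exact: cat_injr.
by rewrite enc_cat enc_rcons eqv !catE.
Qed.

Lemma seq_interp1 (X : symbol letter univ_nt) p s :
  seq_interp (G := univ_grammar) univ_interp [:: X] p s ->
  sym_interp (G := univ_grammar) univ_interp X p s.
Proof. by move=> /= [x [_ [-> hx ->]]]; rewrite cats0. Qed.

Lemma univ_interp_closed rl : rl \in univ_rules -> forall p s,
  (forall a, a \in rconj rl ->
     seq_interp (G := univ_grammar) univ_interp a p s) ->
  (forall a, a \in rleft rl ->
     seq_interp (G := univ_grammar) univ_interp a [::] p) ->
  (forall a, a \in rext rl ->
     seq_interp (G := univ_grammar) univ_interp a [::] (p ++ s)) ->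
  univ_interp (rlhs rl) p s.
Proof.
rewrite /univ_rules /univ_main_rules 2!mem_cat.
case/or3P=> [/mapP[x _ ->]|/mapP[x hx ->]|] //.
  move=> p s /(_ _ (mem_head _ _)) /= [_ [_ [-> -> [v [_ [-> h ->]]]]]] _ _.
  rewrite cats0 inE negb_or h andbT.
  by case: x hx.
rewrite !inE; case/orP=> [/eqP-> //|].
case/orP=> [/eqP-> p s hc _ _|].
  by have /= -> := hc _ (mem_head _ _).
case/orP=> [/eqP-> p s hc _ _|].
  by have /= -> := hc _ (mem_head _ _); exists 0.
case/orP=> [/eqP-> p s hc _ _|].
  have /= [_ [_ [-> -> [_ [_ [-> [m ->] ->]]]]]] := hc _ (mem_head _ _).
  by exists m.+1; rewrite cats0.
(* The letters [Ld], [Ld], [Le] in succession mean that B is empty and the entry has number 0. The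
   remainder has [Lhash] only at its end, so the entry belongs to the last letter. *)
case/orP=> [/eqP-> p s hc _ _ /= p0 w|]; first subst p.
  have /= [x [s0 [-> [z [K [-> hK]]]]]] := hc _ (mem_head _ _).
  case=> [_ [_ [-> -> [_ [_ [-> -> [_ [_ [-> -> [y [s' [-> hy]]]]]]]]]]]].
  case=> [_ [_ [-> -> ->]]]; rewrite !catE => /esym hw.
  have := @enc_locate _ E w z K [::] 0 _ hw.
  case=> v1 [c [v2 [s1 [s2 [C [ew hE ez]]]]]].
  rewrite (_ : encL C ++ _ = (encL C ++ Le :: s2) ++ Lhash :: enc v2);
    last by rewrite !catE.
  move=> ey /andP[h1 h2]; case/cat_sep_first: ey => //.
    by rewrite mem_cat inE !negb_or mem_encL.
  move=> _ /esym/enc_eq0 v20; exists v1, c, K, C; split=> //.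
    by rewrite ew v20 cats1.
  exact: (hK [::] v1 s1).
case/orP=> [/eqP-> p s hc _ _ /=|].
  have /= [z [_ [-> _ [_ [_ [-> -> ->]]]]]] := hc _ (mem_head _ _).
  by exists z, [::].
case/orP=> [/eqP-> p s hc _ _ /=|].
  have /= [_ [s0 [-> [z [K ->]]]]] := hc _ (mem_head _ _).
  case=> _ [_ [-> -> [_ [_ [-> [m ->] ->]]]]].
  by exists z, (rcons K m); rewrite encR_rcons !catE cats0.
case/orP=> [/eqP-> p s hc _ _ /=|].
  have /= [z [_ [-> _ [_ [_ [-> -> ->]]]]]] := hc _ (mem_head _ _).
  by exists z, [::].
case/orP=> [/eqP-> p s hc _ _ /=|].
  have /seq_interp1 /= hT := hc _ (mem_second _ _).
  have /= [s1 [s2 [es [z [K [e1 hK]]]]]] := hc _ (mem_head _ _).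
  case=> s3 [s4 [e2 e3 [s5 [s6 [e4 [m e5] e6]]]]] {hc}; subst.
  exists z, (rcons K m); rewrite encR_rcons; split.
    by rewrite !catE cats0.
  move=> u v s1 ep ez h1 k; rewrite mem_rcons inE => /orP[/eqP->|].
    apply: (hT u v (s1 ++ Lc :: encR K)) => //; last first.
      by rewrite mem_cat inE !negb_or h1 mem_encR.
    by rewrite ez !catE cats0.
  exact: hK ep ez h1 k.
(* [NForm] does not verify K; the extended context does, over the whole prefix. Both readings end at
   the same [Ld], and the last [Lc] before it shows that they concern the same list. *)
case/orP=> [/eqP-> p s hc _ he /=|].
  have /= [s1 [s2 [es [z [K e1]] [s3 [s4 [e2 e3 e4]]]]]] := hc _ (mem_head _ _).
  have /= [t1 [t2 [et [z' [K' [f1 hK]]] [t3 [t4 [f2 f3 f4]]]]]] :=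
    he _ (mem_head _ _).
  subst=> {hc he}; exists z, K, [::]; split; first by rewrite !catE.
  move: et; rewrite !cats0 !cats1 -rcons_cat => /rcons_inj[].
  rewrite catA => /cat_sep_last[]; rewrite ?mem_encR // => ez /encR_inj ->.
  move=> u v s1 ep ez' h1; split=> // k; apply: (hK [::] (u ++ v) s1) => //.
  by rewrite -ez ep ez' enc_cat catA.
case/orP=> [/eqP-> p s hc _ _ /=|].
  have /seq_interp1 /= hT := hc _ (mem_second _ _).
  have /= [s1 [s2 [es [z [K [B [e1 hK]]]]]]] := hc _ (mem_head _ _).
  case=> s3 [s4 [e2 e3 [s5 [s6 [e4 [m e5] e6]]]]] {hc}; subst.
  exists z, K, (rcons B m); rewrite encR_rcons; split.
    by rewrite !catE cats0.
  move=> u v s1 ep ez h1; have [hK1 hB] := hK u v s1 ep ez h1.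
  split=> // k; rewrite mem_rcons inE => /orP[/eqP->|]; last exact: hB.
  apply: (hT u v (s1 ++ Lc :: encR K ++ Ld :: encR B)) => //; last first.
    by rewrite !(mem_cat, inE) !negb_or h1 !mem_encR.
  by rewrite ez !catE cats0.
case/orP=> [/eqP-> p s hc _ _ u v r m ep es h1|].
  have /= [y [s1 [e1 hy [s2 [s3 [e2 e3 e4]]]]]] := hc _ (mem_head _ _).
  subst=> {hc}; move: e1; rewrite catA.
  case/cat_sep_last=> [|//|ey]; first by rewrite mem_nseq andbF.
  move/(congr1 size); rewrite size_nseq => /= ->.
  case: (v) ey => [|c w] ey; first exact: tok_empty.
  have [z hz] := @enc_last _ E (c :: w) ltac:(by []).
  by move: hy; rewrite -ey hz mem_cat mem_rcons inE eqxx.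
(* The last [Lb] identifies the name [m] with the run matched by [NPairR]. The last [Lhash], which
   ends [y], identifies the remainders [r] and [r']. *)
case/orP=> [/eqP-> p s hc _ _ u v r m ep es h1|].
  have /= [x [s1 [e1 hx [s2 [s3 [e2 e3 [s4 [s5 [e4 e5 [s6 [s7 [e6
    [m' [y [r' [e7 hr' hy]]]] [s8 [s9 [e8 e9 e10]]]]]]]]]]]]]]] :=
      hc _ (mem_head _ _).
  subst=> {hc}; move: e1 => /esym; rewrite !catE cats0 cats1 rcons_nseq.
  have -> : x ++ Ld :: La :: nseq m' La ++ Le :: y ++ r' ++ Lb :: nseq m'.+1 La
    = (x ++ Ld :: La :: nseq m' La ++ Le :: y ++ r') ++ Lb :: nseq m'.+1 La.
    by rewrite /= !catE.
  rewrite catA => /cat_sep_last[||ex]; rewrite ?mem_nseq ?andbF //.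
  move/(congr1 size); rewrite !size_nseq => <-.
  case: (hy) => [[z ez] _].
  case: (v) ex => [|c w] ex.
    move: h1; rewrite (esym ex : r = _) ez.
    by rewrite !(mem_cat, inE, mem_rcons) eqxx !orbT.
  have [z' hz] := @enc_last _ E (c :: w) ltac:(by []).
  have [_ er] : x ++ [:: Ld, La & nseq m' La ++ Le :: z] = z' /\ r' = r.
    apply: (@cat_sep_last _ Lhash
      (x ++ [:: Ld, La & nseq m' La ++ Le :: z]) z') => //.
    by move: ex; rewrite hz ez !catE.
  apply: (@tok_of_split _ _ x _ y) => //; last first.
    by move: hy; rewrite -?cats1 !catE.
  by apply: (@cat_injr _ _ _ r); rewrite -ex er /= !catE.
case/orP=> [/eqP-> p s hc _ _ /=|].
  have /= [_ [_ [-> -> [_ [s0 [-> [m [y [r [-> hr hy]]]]]]]]]] :=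
    hc _ (mem_head _ _).
  case=> _ [_ [-> -> ->]].
  exists m.+1, y, r; split=> //; last by move: hy; rewrite !catE.
  by rewrite /= !catE cats1 rcons_nseq.
case/orP=> [/eqP-> p s hc _ _ /=|].
  have /= [_ [_ [-> -> [y [s0 [-> hy]]]]]] := hc _ (mem_head _ _).
  case=> r [_ [-> hr [_ [_ [-> -> ->]]]]].
  by exists 0, y, r.
case/orP=> [/eqP-> p s hc _ _ /=|].
  have /= [_ [_ [-> -> [y [_ [-> _ [_ [_ [-> -> ->]]]]]]]]] :=
    hc _ (mem_head _ _).
  split; first by exists (Le :: y); rewrite cats1.
  move=> u v [|k C] r // _; rewrite encL_cons.
  by case: k.
case/orP=> [/eqP-> p s hc _ _ /=|].
  have /seq_interp1 /= hT := hc _ (mem_second _ _).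
  have /= [s1 [s2 [es [m e1] [s3 [s4 [e2 e3]]]]]] := hc _ (mem_head _ _).
  case=> y [s5 [e4 hy e5]] {hc}; subst; rewrite cats0 !catE in hT hy *.
  split.
    by case: hy => [[z ->] _]; exists (nseq m La ++ Lb :: z); rewrite !catE.
  move=> u v [|k C] r ep; first by case: (m).
  rewrite encL_cons !catE => /cat_nseq_eq[] // ek ey hr k'.
  subst k; rewrite encL_cons !catE in ep.
  rewrite inE => /orP[/eqP->|].
    apply: (hT u v (encL C ++ Le :: r)); rewrite ?ey ?catE //.
    by rewrite mem_cat inE !negb_or hr mem_encL.
  by case: hy => _ hy2; apply: (hy2 u v C r) => //; rewrite !catE.
case/orP=> [/eqP-> p s hc _ _ u v r m ep es h1|].
  have /= [s1 [s2 [e1 e2 [r' [s3 [e3 hr' [s4 [s5 [e4 e5 e6]]]]]]]]] :=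
    hc _ (mem_head _ _).
  subst=> {hc}; move: e1; case: m ep => [|m] //= _ [].
  rewrite !catE; case/cat_sep_first=> // _ /enc_eq0 ->.
  exact: tok_empty.
(* Symmetrically, the first [Lb] and the first [Lhash] determine the name and the remainder of its
   block. *)
case/orP=> [/eqP-> p s hc _ _ u v r m ep es h1|].
  have /= [s1 [s2 [e1 e2 [s3 [s4 [e3 [m' [r' [x [e4 hr' hx]]]] [s5 [s6 [e5 e6
    [s7 [s8 [e7 e8 [y [s9 [e9 hy e10]]]]]]]]]]]]]]] := hc _ (mem_head _ _).
  subst=> {hc}; move: e1 ep hx hy; rewrite !catE cats0.
  case: m => //= m [] /esym/cat_nseq_eq[] // <- /cat_sep_first[] // <- ev.
  move=> ep hx hy; apply: (@tok_of_split _ _ x _ y) => //.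
  - by rewrite -rcons_nseq catE -ev.
  - by move: hx; rewrite -ep.
  by move: hy; rewrite -rcons_nseq -ep !catE.
case/orP=> [/eqP-> p s hc _ _ /=|].
  have /= [_ [_ [-> -> [_ [s0 [-> [m [r [x [-> hr hx]]]]]]]]]] :=
    hc _ (mem_head _ _).
  case=> _ [_ [-> -> ->]].
  exists m.+1, r, x; split=> //; last by move: hx; rewrite !catE.
  by rewrite /= !catE cats1 rcons_nseq.
move/eqP=> -> p s hc _ _ /=.
have /= [_ [_ [-> -> [r [s0 [-> hr]]]]]] := hc _ (mem_head _ _).
case=> _ [_ [-> -> [x [_ [-> hx [_ [_ [-> -> ->]]]]]]]].
exists 0, r, x; split=> //; rewrite /= ?catE //.
by move: hx; rewrite !catE cats1.
Qed.

End Soundness.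

(** * Completeness of the universal grammar on encoded strings *)

Section Completeness.
Variables (Sigma : Type) (E : Sigma -> seq entry).
Local Notation enc := (enc E).
Local Notation D A := (derives (G := univ_grammar) (inr A)).
Local Notation DS := (derives_seq (G := univ_grammar)).

Fixpoint derives_all (l : seq (seq (symbol letter univ_nt))) p v :=
  if l is s :: l' then DS s p v /\ derives_all l' p v else True.

Lemma derives_allP l p v a : derives_all l p v -> a \in l -> DS a p v.
Proof.
elim: l => //= b l IH [hb hl]; rewrite inE => /orP[/eqP->//|]; exact: IH.
Qed.

Lemma univ_step i p v (r := nth (Rule NAny [::] [::] [::]) univ_main_rules i) :
  i < 21 -> derives_all (rconj r) p v ->
  derives_all (rext r) [::] (p ++ v) -> D (rlhs r) p v.
Proof.
move=> hi hc he; apply: (derives_rule (G := univ_grammar)).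
- by rewrite !mem_cat mem_nth ?orbT.
- by move=> a; apply: derives_allP.
- have /allP/(_ r) : all (fun r => nilp (rleft r)) univ_main_rules by [].
  by rewrite mem_nth // => /(_ isT)/nilP->.
- by move=> a; apply: derives_allP.
Qed.

Lemma D_skip p s : Lhash \notin s -> D NSkip p s.
Proof.
elim: s p => [|x s IH] p /=.
  move=> _; apply: (univ_step (i := 1)) => //=; split=> //.
  exact: derives_nil.
rewrite inE negb_or => /andP[hx hs].
apply: (@derives_rule _ univ_grammar
  (Rule NSkip [:: [:: inl x; inr NSkip]] [::] [::])) => //.
  rewrite !mem_cat; apply/or3P; apply: Or32; apply: map_f.
  by case: x hx; rewrite !inE.
move=> a; rewrite inE => /eqP->; apply: derives_seq_term.
by apply/derives_seq1/IH.
Qed.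

Lemma D_any p s : D NAny p s.
Proof.
elim: s p => [|x s IH] p /=.
  by apply: (univ_step (i := 0)) => //=; split=> //; apply: derives_nil.
apply: (@derives_rule _ univ_grammar
  (Rule NAny [:: [:: inl x; inr NAny]] [::] [::])) => //.
  rewrite !mem_cat; apply/or3P; apply: Or31; apply: map_f.
  by case: x; rewrite !inE.
move=> a; rewrite inE => /eqP->; apply: derives_seq_term.
by apply/derives_seq1/IH.
Qed.

Lemma D_run p m : D NRun p (nseq m La).
Proof.
elim: m p => [|m IH] p.
  by apply: (univ_step (i := 2)) => //=; split=> //; apply: derives_nil.
apply: (univ_step (i := 3)) => //=; split=> //; apply: derives_seq_term.
by apply/derives_seq1/IH.
Qed.

Lemma DS_cons A s p v w :
  D A p v -> DS s (p ++ v) w -> DS (inr A :: s) p (v ++ w).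
Proof. exact: derives_cons. Qed.

Lemma D_form p z K : D NForm p (z ++ Lc :: encR K).
Proof.
elim/last_ind: K => [|K m IH].
  apply: (univ_step (i := 5)) => //=; split=> //.
  by apply: DS_cons (D_any _ _) _; apply/derives_seq_term/derives_nil.
apply: (univ_step (i := 6)) => //=; split=> //.
rewrite (_ : z ++ _ = (z ++ Lc :: encR K) ++ Lb :: nseq m La);
  last by rewrite encR_rcons !catE.
apply: DS_cons IH _; apply: derives_seq_term.
exact/derives_seq1/D_run.
Qed.

(** The name of a token lies in the block next to its substring, and [r] is the text of this block
    between the name and the substring. It is arbitrary, since any entry of the block may require
    the token. *)
Definition tok_right m u v := forall r, Lhash \notin r ->
  D NTokR (enc u) (enc v ++ r ++ Lb :: nseq m La).

Definition tok_left m u v := forall p r,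
  p ++ nseq m La ++ Lb :: rcons r Lhash = enc u -> Lhash \notin r ->
  D NTokL p (nseq m La ++ Lb :: rcons r Lhash ++ enc v).

(** Induction on K from its last name: one conjunct drops this name, the other checks its token,
    with [s] and the preceding part of the entry in the role of [r] in [tok_right]. *)
Lemma D_prefix u v s K : Lhash \notin s ->
  (forall k, k \in K -> tok_right k u v) ->
  D NPrefix (enc u) (enc v ++ s ++ Lc :: encR K).
Proof.
move=> hs; elim/last_ind: K => [|K m IH] hK.
  apply: (univ_step (i := 7)) => //=; split=> //; rewrite catA.
  by apply: DS_cons (D_any _ _) _; apply/derives_seq_term/derives_nil.
have {}IH : D NPrefix (enc u) (enc v ++ s ++ Lc :: encR K).
  by apply: IH => k hk; apply: hK; rewrite mem_rcons inE hk orbT.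
apply: (univ_step (i := 8)) => //=; split; last split=> //.
  rewrite (_ : _ ++ _ = (enc v ++ s ++ Lc :: encR K) ++ Lb :: nseq m La);
    last by rewrite encR_rcons !catE.
  apply: DS_cons IH _; apply: derives_seq_term; exact/derives_seq1/D_run.
apply/derives_seq1; rewrite encR_rcons.
rewrite (_ : s ++ _ = (s ++ Lc :: encR K) ++ Lb :: nseq m La);
  last by rewrite !catE.
apply: hK; first by rewrite mem_rcons mem_head.
by rewrite mem_cat inE !negb_or hs mem_encR.
Qed.

Lemma D_right u v s K B : Lhash \notin s ->
  (forall k, k \in K -> tok_right k [::] (u ++ v)) ->
  (forall k, k \in B -> tok_right k u v) ->
  D NRight (enc u) (enc v ++ s ++ Lc :: encR K ++ Ld :: encR B).
Proof.
move=> hs hK; elim/last_ind: B => [|B m IH] hB.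
  apply: (univ_step (i := 9)) => //=; split=> //.
    rewrite (_ : _ ++ _ = ((enc v ++ s) ++ Lc :: encR K) ++ [:: Ld]);
      last by rewrite !catE.
    apply: DS_cons (D_form _ _ _) _; exact/derives_seq_term/derives_nil.
  rewrite (_ : _ ++ _ = (enc (u ++ v) ++ s ++ Lc :: encR K) ++ [:: Ld]);
    last by rewrite enc_cat !catE.
  apply: DS_cons (@D_prefix [::] _ _ _ hs hK) _.
  exact/derives_seq_term/derives_nil.
have {}IH : D NRight (enc u) (enc v ++ s ++ Lc :: encR K ++ Ld :: encR B).
  by apply: IH => k hk; apply: hB; rewrite mem_rcons inE hk orbT.
apply: (univ_step (i := 10)) => //=; split; last split=> //.
  rewrite (_ : _ ++ _ = (enc v ++ s ++ Lc :: encR K ++ Ld :: encR B) ++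
    Lb :: nseq m La); last by rewrite encR_rcons !catE.
  apply: DS_cons IH _; apply: derives_seq_term; exact/derives_seq1/D_run.
apply/derives_seq1; rewrite encR_rcons.
rewrite (_ : s ++ _ = (s ++ Lc :: encR K ++ Ld :: encR B) ++ Lb :: nseq m La);
  last by rewrite !catE.
apply: hB; first by rewrite mem_rcons mem_head.
by rewrite !(mem_cat, inE) !negb_or hs !mem_encR.
Qed.

Lemma D_left p u v C r : Lhash \notin r ->
  p ++ encL C ++ Le :: rcons r Lhash = enc u ->
  (forall k, k \in C -> tok_left k u v) ->
  D NLeft p (encL C ++ Le :: rcons r Lhash ++ enc v).
Proof.
move=> hr; elim: C p => [|m C IH] p ep hC.
  apply: (univ_step (i := 15)) => //=; split=> //; apply: derives_seq_term.
  have [z ->] : exists z, rcons r Lhash ++ enc v = rcons z Lhash.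
    case: (v) => [|c w]; first by exists r; rewrite cats0.
    have [z ->] := @enc_last _ E (c :: w) ltac:(by []).
    by exists (rcons r Lhash ++ z); rewrite rcons_cat.
  rewrite -[rcons z _]cats1; apply: DS_cons (D_any _ _) _.
  exact/derives_seq_term/derives_nil.
rewrite encL_cons !catE in ep *.
apply: (univ_step (i := 16)) => //=; split; last split=> //.
  apply: DS_cons (D_run _ _) _; apply: derives_seq_term; apply/derives_seq1.
  have := IH (rcons (p ++ nseq m La) Lb); rewrite !catE; apply=> // k hk.
  by apply: hC; rewrite inE hk orbT.
apply/derives_seq1.
have := hC m (mem_head _ _) p (encL C ++ Le :: r).
rewrite !catE; apply=> //.
by rewrite mem_cat inE !negb_or hr mem_encL.
Qed.

Lemma D_pairR m p y r : Lhash \notin r ->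
  D NLeft (p ++ rcons (nseq m La) Le) y ->
  D NPairR p (nseq m La ++ Le :: y ++ r ++ Lb :: nseq m La).
Proof.
move=> hr; elim: m p => [|m IH] p hy.
  apply: (univ_step (i := 14)) => //=; split=> //; apply: derives_seq_term.
  apply: DS_cons; first by rewrite -cats1.
  by apply: DS_cons (D_skip _ hr) _; apply/derives_seq_term/derives_nil.
apply: (univ_step (i := 13)) => //=; split=> //.
rewrite (_ : La :: _ = La :: (nseq m La ++ Le :: y ++ r ++ Lb :: nseq m La)
  ++ [:: La]); last by rewrite !catE cats1 rcons_nseq.
apply: derives_seq_term; apply: DS_cons;
  last exact/derives_seq_term/derives_nil.
by apply: IH; rewrite cat_rcons.
Qed.

Lemma D_pairL m p x r : Lhash \notin r ->
  D NRight (p ++ nseq m La ++ Lb :: rcons r Lhash) x ->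
  D NPairL p (nseq m La ++ Lb :: rcons r Lhash ++ x ++ Ld :: nseq m La).
Proof.
move=> hr; elim: m p => [|m IH] p hx.
  apply: (univ_step (i := 20)) => //=; split=> //; apply: derives_seq_term.
  rewrite catE; apply: DS_cons (D_skip _ hr) _; apply: derives_seq_term.
  apply: DS_cons; last exact/derives_seq_term/derives_nil.
  by move: hx; rewrite /= !catE.
apply: (univ_step (i := 19)) => //=; split=> //.
rewrite (_ : La :: _ = La :: (nseq m La ++ Lb :: rcons r Lhash ++ x ++
  Ld :: nseq m La) ++ [:: La]); last by rewrite !catE cats1 rcons_nseq.
apply: derives_seq_term; apply: DS_cons;
  last exact/derives_seq_term/derives_nil.
by apply: IH; rewrite cat_rcons.
Qed.

(** Both forms are proved together, because an entry uses its tokens from K and B in the right form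
    and those from C in the left form. Below, [x] is the text through B and [y] the text from C
    onwards. *)
Lemma D_tok m u v : tok E m u v -> tok_right m u v /\ tok_left m u v.
Proof.
elim=> {m u v} [u|m u v c w K B C hE _ hK _ hB _ hC].
  split=> [r hr|p r ep hr] /=.
    apply: (univ_step (i := 11)) => //=; split=> //.
    by apply: DS_cons (D_skip _ hr) _; apply/derives_seq_term/derives_nil.
  apply: (univ_step (i := 17)) => //=; split=> //; rewrite cats0 -cats1.
  apply: derives_seq_term; apply: DS_cons (D_skip _ hr) _.
  exact/derives_seq_term/derives_nil.
have [s1 [s2 [h1 h2 ec]]] := enc_letter_split hE.
set x := enc v ++ s1 ++ Lc :: encR K ++ Ld :: encR B.
have hx : D NRight (enc u) x.
  apply: D_right => // k hk; [exact: (hK k hk).1|exact: (hB k hk).1].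
set y := encL C ++ Le :: rcons s2 Lhash ++ enc w.
have hy : D NLeft (enc u ++ x ++ Ld :: rcons (nseq m.+1 La) Le) y.
  apply: (@D_left _ (u ++ rcons v c)) => // [|k hk]; last exact: (hC k hk).2.
  by rewrite enc_cat enc_rcons ec /x !catE.
have ex : enc (v ++ c :: w) = x ++ Ld :: nseq m.+1 La ++ Le :: y.
  by rewrite enc_cat enc_cons ec /x /y !catE.
split=> [r hr|p r ep hr].
  rewrite (_ : _ ++ _ = x ++ [:: Ld, La & (nseq m La ++ Le :: y ++ r ++
    Lb :: nseq m La) ++ [:: La]]); last first.
    by rewrite ex !catE cats1 rcons_nseq.
  apply: (univ_step (i := 12)) => //=; split=> //.
  apply: DS_cons hx _; do 2![apply: derives_seq_term].
  apply: DS_cons; last exact/derives_seq_term/derives_nil.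
  by apply: D_pairR => //; move: hy; rewrite /= !catE.
rewrite (_ : _ ++ _ = La :: (nseq m La ++ Lb :: rcons r Lhash ++ x ++
  Ld :: nseq m La) ++ [:: La, Le & y]); last first.
  have -> : enc (v ++ c :: w) = x ++ Ld :: nseq m La ++ [:: La, Le & y].
    by rewrite ex -rcons_nseq !catE.
  by rewrite /= !catE.
apply: (univ_step (i := 18)) => //=; split=> //; apply: derives_seq_term.
apply: DS_cons; first by apply: D_pairL; rewrite // cat_rcons ep.
do 2![apply: derives_seq_term]; apply/derives_seq1.
by move: hy; rewrite -rcons_nseq -ep /= !catE.
Qed.

Lemma univ_complete w : accepts E w -> grammar_lang univ_grammar (enc w).
Proof.
case=> v [c [K [C [-> hE hK]]]].
have [s1 [s2 [h1 h2 ec]]] := enc_letter_split hE.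
rewrite (_ : enc (rcons v c) = (enc v ++ s1 ++ Lc :: encR K) ++
  [:: Ld, Ld, Le & (encL C ++ Le :: s2) ++ [:: Lhash]]); last first.
  by rewrite enc_rcons ec !catE cats1.
apply: (univ_step (i := 4)) => //=; split=> //.
apply: DS_cons.
  by apply: (@D_prefix [::]) => // k hk; apply: (D_tok (hK k hk)).1.
do 3![apply: derives_seq_term].
apply: DS_cons; last exact/derives_seq_term/derives_nil.
by apply: D_skip; rewrite mem_cat inE !negb_or mem_encL.
Qed.

Lemma univ_correct w : grammar_lang univ_grammar (enc w) <-> accepts E w.
Proof.
split=> [H|]; last exact: univ_complete.
have /= closed :=
  derives_interp (G := univ_grammar) (@univ_interp_closed _ E) H.
exact: closed.
Qed.

End Completeness.

(** * From grammars to token systems *)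

Section Width.
Variables (Sigma : finType) (G : grammar Sigma).

Definition bodies : seq (seq (symbol Sigma (gnt G))) :=
  flatten [seq rconj r ++ rleft r ++ rext r | r <- grules G].

(** The successor leaves room for bodies of one symbol even when all bodies of the rules are
    empty. *)
Definition width := (\max_(s <- bodies) size s).+1.

Lemma bodies_width r s :
  r \in grules G -> s \in rconj r ++ rleft r ++ rext r -> size s <= width.
Proof.
move=> hr hs; rewrite leqW //; apply: (@leq_bigmax_seq _ _ _ size) => //.
by apply/flatten_mapP; exists r.
Qed.

End Width.

Section TokenForm.
Variables (Sigma : finType) (G : grammar Sigma).
Implicit Types (u v w : seq Sigma).

Let item : finType := (width G).-bseq (symbol Sigma (gnt G)).

Definition prefix_items u : {set item} :=
  [set s : item | `[< derives_seq (G := G) s [::] u >]].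

(** The last letter of the substring is stored in the token, so a token about [v] concerns the
    derivability of its body on [rcons v a]. A cut at a letter thus leaves [v] for a factor ending
    with that letter and [w] for a factor ending with [a]. *)
Let token : finType := ({set item} * item * {set item} * Sigma)%type.

Definition token_sem (t : option token) u v : Prop :=
  if t is Some (T, s, H, a) then
    T \subset prefix_items u -> H \subset prefix_items (u ++ rcons v a) ->
    derives_seq s u (rcons v a)
  else v = [::].

Definition token_code (t : option token) : nat :=
  if t is Some j then (pickle j).+1 else 0.

Lemma token_code_inj : injective token_code.
Proof. by case=> [j|] [j'|] //= [/(pcan_inj pickleK) ->]. Qed.

Definition token_codes (K : {set option token}) :=
  [seq token_code t | t <- enum K].

Lemma token_codesP K (P : nat -> Prop) :
  (forall k, k \in token_codes K -> P k) <->
  (forall t, t \in K -> P (token_code t)).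
Proof.
split=> hP => [t ht|k /mapP[t]]; first by apply/hP/map_f; rewrite mem_enum.
by rewrite mem_enum => /hP ht ->.
Qed.

Definition sound_split c
    (x : token * {set option token} * {set option token} *
         {set option token}) :=
  let: (j, K, B, C) := x in
  forall u v w,
    (forall t, t \in K -> token_sem t [::] (u ++ v)) ->
    (forall t, t \in B -> token_sem t u v) ->
    (forall t, t \in C -> token_sem t (u ++ rcons v c) w) ->
    token_sem (Some j) u (v ++ c :: w).

Definition sound_accept c (K : {set option token}) :=
  forall u, (forall t, t \in K -> token_sem t [::] u) ->
    grammar_lang G (rcons u c).

Definition sound_entries c : seq entry :=
  [seq let: (j, K, B, C) := x in
       (token_code (Some j), (token_codes K, token_codes B, token_codes C))
     | x <- enum [set x | `[< sound_split c x >]]] ++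
  [seq (0, (token_codes K, [::], [::]))
     | K : {set option token} <- enum [set K | `[< sound_accept c K >]]].

Local Notation tok := (tok sound_entries).

Lemma tok_sound t u v : tok (token_code t) u v -> token_sem t u v.
Proof.
move en: (token_code t) => n H; elim: H t en => {n u v} [u [] //|].
move=> n u v c w K B C hE _ hK _ hB _ hC t et.
move: hE; rewrite mem_cat => /orP[] /mapP; last by case.
case=> [[[[j K'] B'] C']]; rewrite mem_enum inE => /asboolP hs [en eK eB eC].
have -> : t = Some j by apply: token_code_inj; rewrite et en.
apply: hs => t' ht';
  [apply: (hK (token_code t'))|apply: (hB (token_code t'))|
   apply: (hC (token_code t'))];
  by rewrite // (eK, eB, eC) /token_codes map_f ?mem_enum.
Qed.

(* Completeness uses these sets as the hypotheses of tokens: an extended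
   context may require a member of [prefix_items u] that is itself derivable
   only from hypotheses on [u], while forced items follow from tokens alone. *)
Definition forced_items u : {set item} :=
  [set s in prefix_items u | `[< forall u0 c, u = rcons u0 c -> forall u1,
     (forall t, tok (token_code t) [::] u0 -> token_sem t [::] u1) ->
     s \in prefix_items (rcons u1 c) >]].

Lemma forced_items_nil : forced_items [::] \subset prefix_items [::].
Proof. by apply/subsetP => s; rewrite inE => /andP[]. Qed.

Lemma forced_items_rcons u c u1 :
  (forall t, tok (token_code t) [::] u -> token_sem t [::] u1) ->
  forced_items (rcons u c) \subset prefix_items (rcons u1 c).
Proof.
move=> h; apply/subsetP => s; rewrite inE => /andP[_ /asboolP hs].
exact: hs erefl _ h.
Qed.

(** Soundness of an inference quantifies over all strings. Completeness therefore needs an invariant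
    carrying derivability over to any [u'] and [v'], known only through forced items and tokens. *)
Definition transfers (s : seq (symbol Sigma (gnt G))) u v : Prop :=
  (v = [::] -> forall u', forced_items u \subset prefix_items u' ->
     derives_seq s u' [::]) /\
  (forall v0 a, v = rcons v0 a -> forall u' v',
     forced_items u \subset prefix_items u' ->
     forced_items (u ++ v) \subset prefix_items (u' ++ rcons v' a) ->
     (forall t, tok (token_code t) u v0 -> token_sem t u' v') ->
     derives_seq s u' (rcons v' a)).

(** This handles both kinds of contexts: the hypotheses make [s] itself a forced item of [u], the
    items required at the right end being supplied by [forced_items_rcons]. *)
Lemma transfers_prefix (s : seq (symbol Sigma (gnt G))) u u' :
  size s <= width G -> derives_seq s [::] u -> transfers s [::] u ->
  forced_items u \subset prefix_items u' -> derives_seq s [::] u'.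
Proof.
move=> hs hd [_ ht] hu.
suff /(subsetP hu) : (Bseq hs : item) \in forced_items u.
  by rewrite inE => /asboolP.
rewrite !inE; apply/andP; split; first exact/asboolP.
apply/asboolP => u0 c eu u1 hu1; rewrite inE; apply/asboolP.
apply: (ht _ _ eu) (hu1); first exact: forced_items_nil.
by rewrite eu; apply: forced_items_rcons.
Qed.

(** The cut is at [b], the last letter of the factor of [X]. The inference whose premises are all
    tokens inferred about the pieces is sound by the two transfer hypotheses, hence is listed among
    the entries of [b]. *)
Lemma transfers_cat X s u v0 b w0 a (hs : size (X :: s) <= width G) :
  transfers [:: X] u (rcons v0 b) ->
  transfers s (u ++ rcons v0 b) (rcons w0 a) ->
  tok (token_code (Some (forced_items u, Bseq hs,
    forced_items (u ++ rcons v0 b ++ rcons w0 a), a))) u (v0 ++ b :: w0).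
Proof.
move=> [_ hX] [_ hS].
pose true_tokens u v : {set option token} :=
  [set t | `[< tok (token_code t) u v >]].
have true_tokensP u1 v1 : forall k, k \in token_codes (true_tokens u1 v1) ->
    tok k u1 v1.
  by apply/token_codesP => t; rewrite inE => /asboolP.
apply: (@tok_split _ sound_entries _ _ _ _ _
  (token_codes (true_tokens [::] (u ++ v0))) (token_codes (true_tokens u v0))
  (token_codes (true_tokens (u ++ rcons v0 b) w0)));
  try exact: true_tokensP.
rewrite mem_cat; apply/orP; left; set j := (_, _, _, a).
apply/mapP; exists (j, true_tokens [::] (u ++ v0), true_tokens u v0,
  true_tokens (u ++ rcons v0 b) w0) => //.
rewrite mem_enum inE; apply/asboolP => u' v' w' hK hB hC hu hv.
have tt u1 v1 t : tok (token_code t) u1 v1 -> t \in true_tokens u1 v1.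
  by move=> h; rewrite inE; apply/asboolP.
(* The tokens about the prefix before the cut provide the items required at the middle boundary. *)
have hm : forced_items (u ++ rcons v0 b) \subset
    prefix_items (u' ++ rcons v' b).
  by rewrite -!rcons_cat; apply: forced_items_rcons => t /tt /hK.
rewrite rcons_cat rcons_cons -cat_rcons in hv *.
apply: (@derives_cons _ _ X s).
  by apply/derives_seq1; apply: hX => // t /tt /hB.
apply: hS => //; last by move=> t /tt /hC.
by rewrite -!catA.
Qed.

Lemma derives_transfers :
  (forall X u v, derives (G := G) X u v -> transfers [:: X] u v) /\
  (forall s u v, derives_seq (G := G) s u v -> size s <= width G ->
    transfers s u v).
Proof.
apply: derives_both =>
  [a x|r u v hr _ hc dl hl de he|u _|X s u v w _ hX hs IHs hsz].
- split=> // v0 b; rewrite -[[:: a]]/(rcons [::] a) => /rcons_inj[<- <-].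
  (* Here [v0] is empty, and the emptiness token [None] makes [v'] empty too. *)
  move=> u' v' _ _ /(_ None (tok_empty _ _)) /= ->.
  exact/derives_seq1/derives_axiom.
- have hw s : s \in rconj r ++ rleft r ++ rext r -> size s <= width G.
    exact: bodies_width.
  have inc s : s \in rconj r -> size s <= width G.
    by move=> h; apply: hw; rewrite mem_cat h.
  have inl s : s \in rleft r -> size s <= width G.
    by move=> h; apply: hw; rewrite !mem_cat h orbT.
  have ine s : s \in rext r -> size s <= width G.
    by move=> h; apply: hw; rewrite !mem_cat h !orbT.
  split=> [v0 u' hu|v0 a ev u' v' hu hv ht]; apply/derives_seq1.
    subst v; rewrite cats0 in de he.
    apply: (derives_rule hr) => s hs.
    + by apply: (hc s hs (inc s hs)).1.
    + exact: transfers_prefix (inl s hs) (dl s hs) (hl s hs (inl s hs)) hu.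
    rewrite cats0.
    exact: transfers_prefix (ine s hs) (de s hs) (he s hs (ine s hs)) hu.
  apply: (derives_rule hr) => s hs.
  + by apply: (hc s hs (inc s hs)).2 ev _ _ hu hv ht.
  + exact: transfers_prefix (inl s hs) (dl s hs) (hl s hs (inl s hs)) hu.
  exact: transfers_prefix (ine s hs) (de s hs) (he s hs (ine s hs)) hv.
- split=> [_ u' _|v0 a /(congr1 size)]; first exact: derives_nil.
  by rewrite size_rcons.
have {IHs} hS := IHs (ltnW hsz).
case/lastP: v hX hs hS => [|v b] hX hs hS; last first.
  case/lastP: w hs hS => [|w a'] hs hS.
    rewrite !cats0 in hs hS *; split=> [/(congr1 size)|v0 a ev u' v' hu hv ht].
      by rewrite size_rcons.
    rewrite -[rcons v' a]cats0; apply: (@derives_cons _ _ X s).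
      by apply/derives_seq1; apply: hX.2 ev _ _ hu hv ht.
    by apply: hS.1 _ hv; rewrite // -?ev.
  split=> [/(congr1 size)|v0 a]; first by rewrite size_cat !size_rcons addnS.
  rewrite -rcons_cat => /rcons_inj[<- <-] u' v' hu hv ht.
  rewrite cat_rcons in ht; rewrite rcons_cat in hv.
  (* Both factors are nonempty: the token for [X :: s] with the forced items of the two ends as
     hypotheses is inferred, so [ht] makes it true of [u'] and [v']. *)
  exact: ht _ (transfers_cat hsz hX hS) hu hv.
rewrite /= cats0 in hs hS *; split=> [ew u' hu|w0 a ew u' v' hu hv ht].
  apply: (@derives_cons _ _ X s _ [::] [::]).
    by apply/derives_seq1; apply: hX.1.
  by rewrite cats0; apply: hS.1.
apply: (@derives_cons _ _ X s _ [::]); first by apply/derives_seq1; apply: hX.1.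
by rewrite cats0; apply: hS.2 ew _ _ hu hv ht.
Qed.

(** The accepting entry requires all tokens inferred about [u]. On a whole string the hypotheses at
    the left end concern the empty prefix, and those at the right end follow from these tokens. *)
Lemma described_accepts u c :
  grammar_lang G (rcons u c) <-> accepts sound_entries (rcons u c).
Proof.
split=> [H|[v [c' [K [C [/rcons_inj[<- <-]]]]]]].
  pose K : {set option token} := [set t | `[< tok (token_code t) [::] u >]].
  exists u, c, (token_codes K), [::]; split=> //; last first.
    by apply/token_codesP => t; rewrite inE => /asboolP.
  rewrite mem_cat; apply/orP; right; apply/mapP; exists K => //.
  rewrite mem_enum inE; apply/asboolP => u1 hK.
  have [_ hT] := derives_transfers.1 _ _ _ H.
  apply/derives_seq1; apply: hT => //.
  - exact: forced_items_nil.
  - by apply: forced_items_rcons => t ht; apply: hK; rewrite inE; apply/asboolP.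
  by move=> t ht; apply: hK; rewrite inE; apply/asboolP.
rewrite mem_cat => /orP[] /mapP.
  by case=> [[[[j K'] B'] C']].
case=> K'; rewrite mem_enum inE => /asboolP hK [-> _] hT; apply: hK => t ht.
by apply: tok_sound; apply: hT; rewrite /token_codes map_f ?mem_enum.
Qed.

End TokenForm.

(** * Inverse homomorphisms *)

Lemma insub_bseqK n (T : Type) (s : seq T) :
  size s <= n -> insub_bseq n s = s :> seq T.
Proof. by move=> hs; rewrite /insub_bseq /insubd insubT. Qed.

Section InverseMorphism.
Variables (Sigma Gamma : finType) (G : grammar Gamma).
Variable h : seq Sigma -> seq Gamma.
Hypothesis h_morph : str_morphism h.
Variable with_eps : bool.
Implicit Types (u v : seq Sigma) (s t : seq Gamma).

Let h0 : h [::] = [::]. Proof. by case: h_morph. Qed.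
Let hD u v : h (u ++ v) = h u ++ h v. Proof. by case: h_morph. Qed.
Let h_cons c v : h (c :: v) = h [:: c] ++ h v. Proof. exact: hD [:: c] v. Qed.

Let m := \max_(c : Sigma) size (h [:: c]).

Lemma size_image_letter c : size (h [:: c]) <= m.
Proof. exact: (leq_bigmax c). Qed.

(** The cut between [x] and [y] falls within the image of one letter or within [t]. That letter is
    left to [v2], and [r] is the part before the cut. *)
Lemma image_cat_split v t x y : size t <= m -> h v ++ t = x ++ y ->
  exists v1 v2 r,
    [/\ v = v1 ++ v2, x = h v1 ++ r, h v2 ++ t = r ++ y & size r <= m].
Proof.
move=> ht; elim: v x => [|c v IH] x.
  rewrite h0 /= => et; exists [::], [::], x; rewrite h0 /=; split=> //.
  by apply: leq_trans ht; rewrite et size_cat leq_addr.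
rewrite (h_cons c v) -catA => e.
have [hx|hx] := leqP (size x) (size (h [:: c])).
  exists [::], (c :: v), x; rewrite h0 (h_cons c v) -catA; split=> //.
  exact: leq_trans hx (size_image_letter c).
have ex : x = h [:: c] ++ drop (size (h [:: c])) x.
  rewrite -{1}[x](cat_take_drop (size (h [:: c]))); congr (_ ++ _).
  have := congr1 (take (size (h [:: c]))) e.
  by rewrite take_size_cat // takel_cat // ltnW.
move: e; rewrite ex -catA => /eqP; rewrite eqseq_cat // eqxx => /eqP/IH.
case=> v1 [v2 [r [-> er e2 hr]]]; exists (c :: v1), v2, r.
by rewrite (h_cons c v1) -catA -er.
Qed.

(** Overhangs have length at most [m]; one more place is needed in [letter_rules], which append a
    letter. A string that is too long would be replaced by a default, hence the length filters on
    the rules. *)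
Let str : finType := (m.+1).-bseq Gamma.
Let body : finType := (width G).-bseq (symbol Gamma (gnt G)).
Let str_of s : str := insub_bseq _ s.
Let body_of (xi : seq (symbol Gamma (gnt G))) : body := insub_bseq _ xi.
(* [Some (s, xi, t)] derives those [u<v>] for which [h v ++ t = s ++ v'] and
   the sequence [xi] derives [h u ++ s <v'>]; [None] is the initial symbol. *)
Let nonterminal : finType := option (str * body * str).
Let nt (s : str) (xi : body) (t : str) : symbol Sigma nonterminal :=
  inr (Some (s, xi, t)).

Let start_rules : seq (rule Sigma nonterminal) :=
  Rule None
    [:: [:: nt (str_of [::]) (body_of [:: inr (gstart G)]) (str_of [::])]]
    [::] [::] ::
  nseq with_eps
    (Rule None [:: [:: nt (str_of [::]) (body_of [::]) (str_of [::])]]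
      [::] [::]).

Let nil_rules : seq (rule Sigma nonterminal) :=
  [seq Rule (Some (s, body_of [::], s)) [:: [::]] [::] [::]
   | s : str <- enum str].

Let shift_rules : seq (rule Sigma nonterminal) :=
  [seq let: (c, s, t) := x in
     Rule (Some (str_of (h [:: c] ++ s), body_of [::], t))
       [:: [:: inl c; nt s (body_of [::]) t]] [::] [::]
   | x : Sigma * str * str <- enum {: Sigma * str * str} &
     size (h [:: x.1.1] ++ x.1.2) <= m.+1].

Let letter_rules : seq (rule Sigma nonterminal) :=
  [seq let: (a, s, t) := x in
     Rule (Some (s, body_of [:: inl a], t))
       [:: [:: nt (str_of (rcons s a)) (body_of [::]) t]] [::] [::]
   | x : Gamma * str * str <- enum {: Gamma * str * str} & size x.1.2 <= m].

Let cons_rules : seq (rule Sigma nonterminal) :=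
  [seq let: (X, xi, s, r, t) := x in
     Rule (Some (s, body_of (X :: xi), t))
       [:: [:: nt s (body_of [:: X]) r; nt r xi t]] [::] [::]
   | x : symbol Gamma (gnt G) * body * str * str * str
       <- enum {: symbol Gamma (gnt G) * body * str * str * str} &
     size x.1.1.1.2 < width G].

(** The contexts begin at the start of the string, so their first component is empty. The simulated
    left context is [h u ++ s] and the extended one [h (u ++ v) ++ t], which gives the overhangs [s]
    and [t]. *)
Let sim_rule r (s t : str) : rule Sigma nonterminal :=
  Rule (Some (s, body_of [:: inr (rlhs r)], t))
    [seq [:: nt s (body_of xi) t] | xi <- rconj r]
    [seq [:: nt (str_of [::]) (body_of xi) s] | xi <- rleft r]
    [seq [:: nt (str_of [::]) (body_of xi) t] | xi <- rext r].

Let sim_rules : seq (rule Sigma nonterminal) :=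
  flatten [seq [seq sim_rule r x.1 x.2 | x : str * str <- enum {: str * str}]
          | r <- grules G].

Definition preim_rules :=
  start_rules ++ nil_rules ++ shift_rules ++ letter_rules ++ cons_rules ++
  sim_rules.

Lemma preim_rules_conj : all (fun r => 0 < size (rconj r)) preim_rules.
Proof.
rewrite /preim_rules !all_cat /= all_nseq orbT /=.
apply/and5P; split; apply/allP => x.
- by case/mapP => y _ ->.
- by case/mapP => [[[? ?] ?] _ ->].
- by case/mapP => [[[? ?] ?] _ ->].
- by case/mapP => [[[[[? ?] ?] ?] ?] _ ->].
case/flatten_mapP => r hr /mapP[y _ ->] /=.
by rewrite size_map; apply: (allP (grules_conj G)).
Qed.

Definition preim_grammar : grammar Sigma := Grammar None preim_rules_conj.

Local Notation D s xi t := (derives (G := preim_grammar) (nt s xi t)).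

Definition preim_interp (A : nonterminal) u v : Prop :=
  if A is Some (s, xi, t) then
    exists2 v', h v ++ t = s ++ v' & derives_seq xi (h u ++ s) v'
  else derives_seq [:: inr (gstart G)] (h u) (h v) \/ with_eps /\ h v = [::].

Lemma preim_interp_closed r : r \in preim_rules -> forall u v,
  (forall a, a \in rconj r ->
     seq_interp (G := preim_grammar) preim_interp a u v) ->
  (forall a, a \in rleft r ->
     seq_interp (G := preim_grammar) preim_interp a [::] u) ->
  (forall a, a \in rext r ->
     seq_interp (G := preim_grammar) preim_interp a [::] (u ++ v)) ->
  preim_interp (rlhs r) u v.
Proof.
have one A u v : seq_interp (G := preim_grammar) preim_interp [:: inr A] u v ->
    preim_interp A u v.
  by move=> /= [x [_ [-> hx ->]]]; rewrite cats0.
have S0 : str_of [::] = [::] :> seq _ by rewrite insub_bseqK.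
have BK xi : size xi <= width G -> body_of xi = xi :> seq _.
  exact: insub_bseqK.
rewrite /preim_rules !mem_cat => /or4P[|||/or3P[]].
- rewrite in_cons => /predU1P[->|/nseqP[-> he]] u v.
    move=> /(_ _ (mem_head _ _))/one [v' ev hv] _ _; left.
    by move: ev hv; rewrite S0 BK // !cats0 => ->.
  move=> /(_ _ (mem_head _ _))/one [v' ev hv] _ _.
  right; split; first by case: with_eps he.
  by move: ev hv; rewrite S0 BK // !cats0 => -> /= /derives_seq0.
- case/mapP=> s _ -> u v /(_ _ (mem_head _ _)) /= -> _ _.
  by exists [::]; rewrite /= ?BK // ?h0 ?cats0 //; apply: derives_nil.
- case/mapP=> [[[c s] t]]; rewrite mem_filter => /andP[/= hs _] -> u v.
  move=> /(_ _ (mem_head _ _)) /=.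
  case=> [_ [x [-> -> [v1 [_ [-> [v' ev hv] ->]]]]]] _ _.
  move: hv ev; rewrite BK // => /derives_seq0-> ev.
  exists [::]; last by rewrite /= ?BK //; apply: derives_nil.
  by rewrite /= insub_bseqK // !cats0 (h_cons c v1) -catA ev cats0.
- case/mapP=> [[[a s] t]]; rewrite mem_filter => /andP[/= hs _] -> u v.
  move=> /(_ _ (mem_head _ _))/one [v' ev hv] _ _.
  move: hv ev; rewrite BK // => /derives_seq0-> ev.
  exists [:: a]; last by rewrite /= ?BK //; apply/derives_seq1/derives_axiom.
  by rewrite ev insub_bseqK ?size_rcons // cats0 cats1.
- case/mapP=> [[[[[X xi] s] r'] t]]; rewrite mem_filter.
  move=> /andP[/= hs _] -> u v.
  move=> /(_ _ (mem_head _ _)) /=.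
  case=> [v1 [x [-> [w1 e1 d1] [v2 [_ [-> [w2 e2 d2] ->]]]]]] _ _.
  exists (w1 ++ w2); first by rewrite cats0 hD -catA e2 catA e1 catA.
  rewrite /= ?BK //; apply: derives_cons.
    by apply/derives_seq1; move: d1; rewrite BK.
  by rewrite -catA -e1 catA -hD.
case/flatten_mapP=> r' hr' /mapP[[s t] _ ->] u v /= hc hl he.
(* Some conjunct must exist to supply the remainder [v']; it is the same for all conjuncts by
   cancelling [s]. *)
have [al hal] : exists al, al \in rconj r'.
  have := allP (grules_conj G) _ hr'; case: (rconj r') => // al l _.
  by exists al; apply: mem_head.
have hw xi : xi \in rconj r' ++ rleft r' ++ rext r' -> size xi <= width G.
  exact: bodies_width.
have [v' ev _] := one _ _ _ (hc _ (map_f _ hal)).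
exists v'; rewrite /= ?BK //; apply/derives_seq1.
apply: (derives_rule hr') => xi hxi.
- have [w ew] := one _ _ _ (hc _ (map_f _ hxi)).
  rewrite BK ?hw ?mem_cat ?hxi //.
  by move: ew; rewrite ev => /eqP; rewrite eqseq_cat // eqxx => /eqP->.
- have [w ew] := one _ _ _ (hl _ (map_f _ hxi)).
  rewrite S0 BK ?hw ?mem_cat ?hxi ?orbT // h0.
  by move: ew; rewrite S0 => ->.
have [w ew] := one _ _ _ (he _ (map_f _ hxi)).
rewrite S0 BK ?hw ?mem_cat ?hxi ?orbT // h0.
by move: ew; rewrite S0 hD -!catA ev => ->.
Qed.

Lemma derives_nil_preim u v (s t : str) :
  h v ++ t = s -> D s (body_of [::]) t u v.
Proof.
elim: v u s => [|c v IH] u s.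
  rewrite h0 => /val_inj->.
  apply: (derives_rule (G := preim_grammar)
    (r := Rule (Some (s, body_of [::], s)) [:: [::]] [::] [::])) => //.
    by rewrite !mem_cat map_f ?orbT // mem_enum.
  by move=> a; rewrite inE => /eqP->; apply: derives_nil.
rewrite (h_cons c v) -catA => e.
have hs : size (h v ++ t) <= m.+1.
  by apply: leq_trans (size_bseq s); rewrite -e [leqRHS]size_cat leq_addl.
have es : str_of (h [:: c] ++ str_of (h v ++ t)) = s.
  by apply: val_inj; rewrite /= !insub_bseqK // e ?size_bseq.
rewrite -es; apply: (derives_rule (G := preim_grammar)
  (r := Rule (Some (str_of (h [:: c] ++ str_of (h v ++ t)), body_of [::], t))
    [:: [:: inl c; nt (str_of (h v ++ t)) (body_of [::]) t]] [::] [::])) => //.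
  rewrite !mem_cat; do 2!(apply/orP; right); apply/orP; left.
  apply/mapP; exists (c, str_of (h v ++ t), t) => //.
  by rewrite mem_filter mem_enum /= insub_bseqK // e size_bseq.
move=> a; rewrite inE => /eqP->; apply: derives_seq_term; apply/derives_seq1.
by apply: IH; rewrite insub_bseqK.
Qed.

Lemma derives_preim :
  (forall X p w, derives (G := G) X p w -> forall u v (s t : str),
     p = h u ++ s -> size s <= m -> size t <= m -> h v ++ t = s ++ w ->
     D s (body_of [:: X]) t u v) /\
  (forall xi p w, derives_seq (G := G) xi p w -> forall u v (s t : str),
     size xi <= width G ->
     p = h u ++ s -> size s <= m -> size t <= m -> h v ++ t = s ++ w ->
     D s (body_of xi) t u v).
Proof.
apply: derives_both.
- move=> a p u v s t _ hs ht e.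
  apply: (derives_rule (G := preim_grammar)
    (r := Rule (Some (s, body_of [:: inl a], t))
       [:: [:: nt (str_of (rcons s a)) (body_of [::]) t]] [::] [::])) => //.
    rewrite !mem_cat; do 3!(apply/orP; right); apply/orP; left.
    by apply/mapP; exists (a, s, t); rewrite // mem_filter mem_enum hs.
  move=> x; rewrite inE => /eqP->; apply/derives_seq1.
  by apply: derives_nil_preim; rewrite insub_bseqK ?size_rcons // -cats1.
- move=> r p w hr _ hc _ hl _ he u v s t ep hs ht e.
  have hw xi : xi \in rconj r ++ rleft r ++ rext r -> size xi <= width G.
    exact: bodies_width.
  have S0 : str_of [::] = [::] :> seq _ by rewrite insub_bseqK.
  apply: (derives_rule (G := preim_grammar) (r := sim_rule r s t)).
  + rewrite !mem_cat; do 5!(apply/orP; right).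
    apply/flatten_mapP; exists r => //.
    by apply/mapP; exists (s, t); rewrite ?mem_enum.
  + move=> x /mapP[xi hxi ->]; apply/derives_seq1.
    by apply: hc; rewrite // hw // mem_cat hxi.
  + move=> x /mapP[xi hxi ->]; apply/derives_seq1.
    by apply: hl; rewrite ?S0 ?h0 // hw // !mem_cat hxi orbT.
  move=> x /mapP[xi hxi ->]; apply/derives_seq1.
  apply: he; rewrite ?S0 ?h0 // ?hw // ?mem_cat ?hxi ?orbT //.
  by rewrite hD -catA e ep -catA.
- move=> p u v s t _ _ hs ht; rewrite cats0; exact: derives_nil_preim.
move=> X xi p w1 w2 _ hX _ hxi u v s t hsz ep hs ht.
(* The boundary between [X] and [xi] may lie inside the image of a letter; [r] is the overhang
   passed between the two nonterminals. *)
rewrite catA => /(image_cat_split ht) [v1 [v2 [r [-> e1 e2 hr]]]].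
have Sr : str_of r = r :> seq _ by rewrite insub_bseqK // leqW.
have Bxi : body_of xi = xi :> seq _ by rewrite insub_bseqK // ltnW.
apply: (derives_rule (G := preim_grammar)
  (r := Rule (Some (s, body_of (X :: xi), t))
    [:: [:: nt s (body_of [:: X]) (str_of r); nt (str_of r) (body_of xi) t]]
    [::] [::])) => //.
  rewrite !mem_cat; do 4!(apply/orP; right); apply/orP; left.
  apply/mapP; exists (X, body_of xi, s, str_of r, t); last by rewrite Bxi.
  by rewrite mem_filter mem_enum /= Bxi andbT.
move=> x; rewrite inE => /eqP->; apply: derives_cons.
  by apply: hX; rewrite ?Sr.
apply/derives_seq1; apply: hxi; rewrite ?Sr // 1?ltnW //.
by rewrite ep hD -!catA e1.
Qed.

Lemma described_preim :
  described (fun w => grammar_lang G (h w) \/ with_eps /\ h w = [::]).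
Proof.
exists preim_grammar => w; split; last first.
  move=> H.
  have /= := derives_interp (G := preim_grammar) preim_interp_closed H.
  by rewrite h0 => -[/derives_seq1|]; [left|right].
have S0 : str_of [::] = [::] :> seq _ by rewrite insub_bseqK.
case=> [H|[he hw]].
  apply: (derives_rule (G := preim_grammar)
    (r := Rule None
      [:: [:: nt (str_of [::]) (body_of [:: inr (gstart G)]) (str_of [::])]]
      [::] [::])) => //.
    by rewrite mem_cat mem_head.
  move=> x; rewrite inE => /eqP->; apply/derives_seq1.
  by apply: (derives_preim.1 _ _ _ H); rewrite S0 ?h0 ?cats0.
apply: (derives_rule (G := preim_grammar)
  (r := Rule None [:: [:: nt (str_of [::]) (body_of [::]) (str_of [::])]]
    [::] [::])) => //.
  by rewrite mem_cat in_cons mem_nseq he eqxx !orbT.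
move=> x; rewrite inE => /eqP->; apply/derives_seq1.
by apply: derives_nil_preim; rewrite hw S0.
Qed.

End InverseMorphism.

(** * The characterization, from the universal grammar and closure under preimages *)

Theorem corollary1 :
  exists L0 : language letter,
    described L0 /\
    forall (Sigma : finType) (L : language Sigma),
      (~ L [::] ->
        (described L <->
         exists h : seq Sigma -> seq letter,
           str_morphism h /\ lang_eq L (lang_preim h L0))) /\
      (L [::] ->
        (described L <->
         exists h : seq Sigma -> seq letter,
           str_morphism h /\
           lang_eq L (lang_preim h (lang_add_eps L0)))).
Proof.
exists (grammar_lang univ_grammar); split; first by exists univ_grammar.
move=> Sigma L; split=> hL; split.
- case=> G hG; exists (enc (sound_entries G)); split.
    by split=> // u v; apply: enc_cat.
  (* The empty string is never accepted, since acceptance is witnessed by an entry of the last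
     letter. *)
  move=> w; rewrite /lang_preim univ_correct; case/lastP: w => [|w c].
    by split=> // -[v [c [K [C [/(congr1 size)]]]]]; rewrite size_rcons.
  by rewrite hG described_accepts.
- case=> h [hh hG]; have [G' hG'] := described_preim univ_grammar hh false.
  by exists G' => w; rewrite -hG' hG; split=> [|[|[]]] //; left.
- case=> G hG; exists (enc (sound_entries G)); split.
    by split=> // u v; apply: enc_cat.
  move=> w; rewrite /lang_preim /lang_add_eps univ_correct.
  case/lastP: w => [|w c]; first by split=> // _; right.
  (* Only the empty string has an empty code, so adding the empty string to the fixed language does
     not affect [rcons w c]. *)
  rewrite hG described_accepts; split=> [|[//|/enc_eq0/(congr1 size)]].
    by left.
  by rewrite size_rcons.
case=> h [hh hG]; have [G' hG'] := described_preim univ_grammar hh true.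
exists G' => w; rewrite -hG' hG; split=> [[|]|[|[_]]]; by [left|right].
Qed.
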